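(* Let $C_n(x)$ be the second-order Eulerian polynomials. For $n\ge1$, $$C_n(x)=\sum_{T\in\mathrm{SYT}(n)}\left(\prod_{i=1}^n\sigma_i(T)\,(i!)^{w_i(T)}\right)x^{n+1-\ell(\lambda(T))}.$$
   Context: A Stirling permutation of order $n$ is a permutation $\sigma=\sigma_1\cdots\sigma_{2n}$ of the multiset $\{1^2,2^2,\dots,n^2\}$ such that for each $i$ all entries between the two occurrences of $i$ are at least $i$; $\mathcal Q_n$ is the set of these. $C_n(x)=\sum_{\sigma\in\mathcal Q_n}x^{\mathrm{des}(\sigma)}$ with $\mathrm{des}(\sigma)=\#\{i\in[2n]:\sigma_i>\sigma_{i+1}\}$, $\sigma_{2n+1}=0$. A standard Young tableau of size $n$ is a filling of the Ferrers diagram of a partition $\lambda\vdash n$ (French convention: left-justified rows numbered from bottom to top, $\lambda_i$ boxes in row $i$) with $1,\dots,n$, each used exactly once, increasing from left to right in rows and from bottom to top in columns; $\mathrm{SYT}(n)$ is the set of all of them, over all $\lambda\vdash n$. For $T\in\mathrm{SYT}(n)$, $\ell(\lambda(T))$ is the number of rows of $T$, $w_i(T)$ is the number of rows of $T$ with exactly $i$ boxes, $T_i$ is the tableau obtained from $T$ by deleting the entries $i+1,\dots,n$, and $\mathrm{col}_k(T_i)$ is the number of boxes in the $k$-th column of $T_i$. The box sorting index of $i$ is $$\sigma_i(T)=\begin{cases} i-\mathrm{col}_1(T_i)+1, & \text{if } i \text{ is in the first column of } T,\\ \mathrm{col}_k(T_i)-\mathrm{col}_{k+1}(T_i)+1,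 & \text{if } i \text{ is in the } (k+1)\text{-th column of } T,\ k\ge1.\end{cases}$$ *)

(* Defs.v *)
From mathcomp Require Import all_boot all_order all_algebra.

Set Implicit Arguments.
Unset Strict Implicit.
Unset Printing Implicit Defensive.

Import GRing.Theory.

(* Words and tableaux are sequences of natural numbers and sequences of rows;
   the letters 1, ..., n are the naturals themselves.  The bounded types
   (2 * n).-tuple 'I_n.+1 and n.-bseq (n.-bseq 'I_n.+1) only provide a finite
   type to sum over: their bounds hold for every Stirling permutation of order
   n and every standard Young tableau of size n. *)

Local Open Scope nat_scope.

(* The entries strictly between the first two occurrences of i in s. *)
Definition between (i : nat) (s : seq nat) : seq nat :=
  let u := drop (index i s).+1 s in take (index i u) u.

Definition is_stirling (n : nat) (s : seq nat) : bool :=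
  perm_eq s (flatten [seq [:: i; i] | i <- iota 1 n]) &&
  all (fun i => all (leq i) (between i s)) (iota 1 n).

(* Appending 0 encodes the convention on the entry following the last one. *)
Definition des (s : seq nat) : nat :=
  let s0 := rcons s 0 in
  count (fun i => nth 0 s0 i > nth 0 s0 i.+1) (iota 0 (size s)).

Definition word (n m : nat) (s : m.-tuple 'I_n.+1) : seq nat := map val s.

Definition stirling_perms (n : nat) : {set (2 * n).-tuple 'I_n.+1} :=
  [set s | is_stirling n (word s)].

Definition second_order_eulerian (n : nat) : {poly int} :=
  (\sum_(s in stirling_perms n) 'X^(des (word s)))%R.

(* French convention: a tableau is the list of its rows, the bottom (longest)
   row first, each row being read from left to right. *)
Definition tableau := seq (seq nat).

Definition shape (T : tableau) : seq nat := map size T.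

Definition is_partition_of (n : nat) (lam : seq nat) : bool :=
  [&& sorted geq lam, 0 \notin lam & sumn lam == n].

(* The k-th column (k >= 1), read from bottom to top. *)
Definition column (k : nat) (T : tableau) : seq nat :=
  [seq nth 0 r k.-1 | r <- T & k <= size r].

Definition is_syt (n : nat) (T : tableau) : bool :=
  [&& is_partition_of n (shape T),
      perm_eq (flatten T) (iota 1 n),
      all (sorted ltn) T
    & all (fun k => sorted ltn (column k T)) (iota 1 n)].

Definition rows (n : nat) (T : n.-bseq (n.-bseq 'I_n.+1)) : tableau :=
  [seq [seq val a | a <- bseqval r] | r <- bseqval T].

Definition SYT (n : nat) : {set n.-bseq (n.-bseq 'I_n.+1)} :=
  [set T | is_syt n (rows T)].

Definition nrows (T : tableau) : nat := size T.

Definition rows_of_size (i : nat) (T : tableau) : nat :=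
  count (fun r => size r == i) T.

(* T_i: the boxes with entries > i are deleted, and with them the rows that
   have become empty. *)
Definition restrict (i : nat) (T : tableau) : tableau :=
  [seq r <- [seq [seq a <- r | a <= i] | r <- T] | r != [::]].

Definition col (k : nat) (T : tableau) : nat := size (column k T).

(* The index, starting from 1, of the column of T containing the entry i. *)
Definition col_index (i : nat) (T : tableau) : nat :=
  (index i (nth [::] T (find (fun r => i \in r) T))).+1.

(* In the second case the entry i lies in column j = k + 1 with k >= 1. *)
Definition box_sorting_index (i : nat) (T : tableau) : int :=
  let j := col_index i T in
  (if j == 1%N then i%:Z - (col 1 (restrict i T))%:Z + 1
   else (col j.-1 (restrict i T))%:Z - (col j (restrict i T))%:Z + 1)%R.

(* Main.v *)
Require Import Defs.
From mathcomp Require Import all_boot all_order all_algebra.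
From mathcomp Require Import zify ring.

(** Both sides satisfy the recurrence P_(n+1) = x (1 - x) P_n' + (2 n + 1) x P_n,
    that is, passing from order n to order n + 1 replaces each monomial x^k by
    k x^k + (2 n + 1 - k) x^(k+1).

    On the side of Stirling permutations, the two copies of the largest letter
    are adjacent, so every permutation of order n + 1 arises once by inserting a
    block N N in one of the 2 n + 1 gaps of a permutation of order n.  If the
    latter has k descents, insertion in a descent gives k descents and insertion
    elsewhere gives k + 1 (lemma sum_insert_pair).

    On the side of tableaux, the largest entry of a tableau of size n + 1 ends
    the first row of some length k of a tableau T of size n, or forms a new row
    (k = 0).  The box sorting index of that entry is the number of rows of T of
    length k when k > 0, and n + 1 - l when k = 0, where l is the number of rows
    of T; the indices of the other entries are unchanged.  The product of the
    factorials of the row lengths is multiplied by k + 1.  Let p = n + 1 - l be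
    the exponent of T.  A new row has weight p and keeps the exponent, while the
    extensions of an existing row raise it by one and have total weight the sum
    over the rows of (length + 1), namely n + l = 2 n + 1 - p (lemma sum_grow).

    In both cases the objects are listed by recursion along these generating
    trees, and the lists are shown to enumerate them without repetition. *)

Set Implicit Arguments.
Unset Strict Implicit.
Unset Printing Implicit Defensive.

Import GRing.Theory.

(** * Sums over bounded words and tableaux *)

(** Both sides of the identity are sums over a finite type that merely bounds
    the combinatorial objects.  This lemma trades such a sum for one over an
    explicit list of unbounded words or tableaux, which can be built by
    recursion on the order without changing types. *)
Lemma sum_finset_list (I : finType) (U : eqType) (V : nmodType) (f : I -> U)
    (P : pred U) (L : seq U) (F : U -> V) :
  injective f -> uniq L -> L =i P -> (forall x, P x -> exists i, f i = x) ->
  (\sum_(i | P (f i)) F (f i) = \sum_(x <- L) F x)%R.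
Proof.
move=> f_inj uL memL surj; rewrite -big_filter.
rewrite -(big_map f predT F); apply: perm_big; apply: uniq_perm => //.
  by rewrite map_inj_uniq // filter_uniq // index_enum_uniq.
move=> x; rewrite memL; apply/mapP/idP => [[i]|Px].
  by rewrite mem_filter => /andP[Pi _] ->.
have [i def_x] := surj x Px; exists i => //.
by rewrite mem_filter mem_index_enum /= def_x andbT.
Qed.

(** * The recurrence operator *)

(** The second-order Eulerian recurrence
    C_(n+1) = x (1 - x) C_n' + (2 n + 1) x C_n as an operator on C_n. *)
Definition eulerian_step (n : nat) (p : {poly int}) : {poly int} :=
  ('X * (1 - 'X) * p^`() + 'X * p *+ (2 * n).+1)%R.

Lemma eulerian_step_sum (n : nat) (I : Type) (r : seq I) (F : I -> {poly int}) :
  (eulerian_step n (\sum_(i <- r) F i) = \sum_(i <- r) eulerian_step n (F i))%R.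
Proof.
rewrite /eulerian_step (raddf_sum (@deriv int)) big_split /=; congr (_ + _)%R.
  by rewrite mulr_sumr.
by rewrite mulr_sumr sumrMnl.
Qed.

(** The combinatorial meaning of the operator: an object of statistic k has
    2 n + 1 children, counted with weight, of which k keep the statistic and
    the others raise it by one. *)
Lemma eulerian_step_monomial (n k : nat) (c : int) : k <= (2 * n).+1 ->
  (eulerian_step n (c *: 'X^k) =
   (c * k%:R) *: 'X^k + (c * ((2 * n).+1 - k)%:R) *: 'X^(k.+1))%R.
Proof.
move=> le_k; rewrite /eulerian_step derivZ derivXn.
have -> : ('X * (1 - 'X) * (c *: ('X^(k.-1) *+ k)) =
    c *: ('X^k *+ k - 'X^(k.+1) *+ k) :> {poly int})%R.
  rewrite -scalerAr mulrnAr -mulrnBl; congr (_ *: _)%R.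
  case: k {le_k} => [|k] /=; first by rewrite !mulr0n.
  by rewrite mulrAC -exprS mulrBr mulr1 -exprSr.
rewrite -scalerAr -exprS scalerMnr -scalerDr -!scalerA -scalerDr.
by rewrite !scaler_nat mulrnBr // -addrA (addrC (- _)%R).
Qed.

(** * Insertion of the largest pair in a Stirling permutation *)

Lemma drop_index_filter (U : eqType) (p : pred U) (i : U) (s : seq U) : p i ->
  drop (index i (filter p s)).+1 (filter p s) =
  filter p (drop (index i s).+1 s).
Proof.
move=> pi; elim: s => //= x s IHs; case: eqP => [-> | xi].
  by rewrite pi /= eqxx !drop0.
by case: ifP => px //=; case: eqP => // /xi.
Qed.

Lemma take_index_filter (U : eqType) (p : pred U) (i : U) (s : seq U) : p i ->
  take (index i (filter p s)) (filter p s) = filter p (take (index i s) s).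
Proof.
move=> pi; elim: s => //= x s IHs; case: eqP => [-> | xi].
  by rewrite pi /= eqxx.
by case: ifP => px //=; rewrite px //; case: eqP => [/xi|_] //=; rewrite IHs.
Qed.

(** Deleting letters other than i commutes with extracting the factor between
    the two occurrences of i, so the Stirling condition at the small letters
    can be compared before and after the removal of the largest one. *)
Lemma between_filter (p : pred nat) (i : nat) (s : seq nat) : p i ->
  between i (filter p s) = filter p (between i s).
Proof.
by move=> pi; rewrite /between drop_index_filter // take_index_filter.
Qed.

Lemma between_split (i : nat) (a b c : seq nat) : i \notin a -> i \notin b ->
  between i (a ++ i :: b ++ i :: c) = b.
Proof.
move=> ia ib; rewrite /between index_cat (negPf ia) /= eqxx addn0.
rewrite drop_cat ltnNge leqnSn /= subSnn /= drop0.
by rewrite index_cat (negPf ib) /= eqxx addn0 take_size_cat.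
Qed.

Lemma split_first (U : eqType) (x : U) (s : seq U) : x \in s ->
  exists a b, s = a ++ x :: b /\ x \notin a.
Proof.
move=> xs; exists (take (index x s) s), (drop (index x s).+1 s); split.
  rewrite -{1}(cat_take_drop (index x s) s) (drop_nth x) ?index_mem //.
  by rewrite nth_index.
by apply/negP => /index_ltn; rewrite ltnn.
Qed.

Lemma iota1S (n : nat) : iota 1 n.+1 = iota 1 n ++ [:: n.+1].
Proof. by rewrite -[n.+1 in LHS]addn1 iotaD add1n. Qed.

Definition insert_pair (N : nat) (s : seq nat) (j : nat) : seq nat :=
  take j s ++ [:: N, N & drop j s].

Definition pairs_upto (n : nat) : seq nat :=
  flatten [seq [:: i; i] | i <- iota 1 n].

Lemma pairs_uptoS (n : nat) :
  pairs_upto n.+1 = pairs_upto n ++ [:: n.+1; n.+1].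
Proof.
by rewrite /pairs_upto iota1S map_cat flatten_cat.
Qed.

Lemma mem_pairs_upto (n i : nat) : (i \in pairs_upto n) = (0 < i <= n).
Proof.
elim: n => [|n IHn]; first by case: i.
by rewrite pairs_uptoS mem_cat IHn !inE; lia.
Qed.

Lemma size_pairs_upto (n : nat) : size (pairs_upto n) = 2 * n.
Proof. by elim: n => // n IHn; rewrite pairs_uptoS size_cat IHn /=; lia. Qed.

Lemma is_stirling_perm (n : nat) (s : seq nat) :
  is_stirling n s -> perm_eq s (pairs_upto n).
Proof. by case/andP. Qed.

Lemma size_stirling (n : nat) (s : seq nat) : is_stirling n s -> size s = 2 * n.
Proof. by move/is_stirling_perm/perm_size ->; rewrite size_pairs_upto. Qed.

Lemma mem_stirling (n : nat) (s : seq nat) (i : nat) :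
  is_stirling n s -> (i \in s) = (0 < i <= n).
Proof. by move/is_stirling_perm/perm_mem ->; rewrite mem_pairs_upto. Qed.

Lemma perm_insert_pair (N : nat) (s : seq nat) (j : nat) :
  perm_eq (insert_pair N s j) (s ++ [:: N; N]).
Proof.
rewrite /insert_pair -{3}(cat_take_drop j s) -catA perm_cat2l.
by rewrite perm_sym (perm_catC _ [:: N; N]).
Qed.

Lemma filter_insert_pair (N : nat) (s : seq nat) (j : nat) : N \notin s ->
  filter (predC1 N) (insert_pair N s j) = s.
Proof.
move=> Ns; rewrite /insert_pair filter_cat /= eqxx /= -filter_cat cat_take_drop.
by apply/all_filterP/allP => x xs; apply: contraNneq Ns => <-.
Qed.

Lemma index_insert_pair (N : nat) (s : seq nat) (j : nat) :
  N \notin s -> j <= size s -> index N (insert_pair N s j) = j.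
Proof.
move=> Ns le_j; rewrite /insert_pair index_cat /= eqxx addn0 size_takel //.
by rewrite (contraNF (@mem_take _ _ _ _) Ns).
Qed.

(** The deleted letter n+1 is above every i <= n, so it can neither create nor
    repair a violation of the Stirling condition at i. *)
Lemma all_between_filter (n : nat) (t : seq nat) :
  all (fun i => all (leq i) (between i (filter (predC1 n.+1) t))) (iota 1 n) =
  all (fun i => all (leq i) (between i t)) (iota 1 n).
Proof.
apply: eq_in_all => i; rewrite mem_iota => lt_i.
have iN : i != n.+1 by lia.
rewrite between_filter // all_filter; apply: eq_in_all => x _ /=.
by case: eqP => //= ->; lia.
Qed.

Lemma is_stirlingS (n : nat) (t : seq nat) :
  is_stirling n.+1 t =
  [&& perm_eq t (pairs_upto n ++ [:: n.+1; n.+1]),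
      all (leq n.+1) (between n.+1 t) &
      all (fun i => all (leq i) (between i (filter (predC1 n.+1) t)))
          (iota 1 n)].
Proof.
rewrite all_between_filter -pairs_uptoS /is_stirling.
by rewrite -/(pairs_upto _) iota1S all_cat /= andbT [X in _ && X]andbC.
Qed.

Lemma stirling_insert (n : nat) (s : seq nat) (j : nat) :
  is_stirling n s -> is_stirling n.+1 (insert_pair n.+1 s j).
Proof.
move=> st_s; have Ns : n.+1 \notin s by rewrite (mem_stirling _ st_s) ltnn andbF.
rewrite is_stirlingS filter_insert_pair //; case/andP: st_s => s_perm ->.
rewrite (perm_trans (perm_insert_pair _ _ _)) ?perm_cat2r //=.
have Na : n.+1 \notin take j s by apply: contra Ns => /mem_take.
by rewrite /insert_pair (between_split (b := [::])).
Qed.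

(** The entries between the two copies of the largest letter N are at least N,
    hence equal to N; as N occurs only twice, the two copies are adjacent. *)
Lemma stirling_remove (n : nat) (t : seq nat) : is_stirling n.+1 t ->
  exists s j, [/\ is_stirling n s, j <= 2 * n & t = insert_pair n.+1 s j].
Proof.
set N := n.+1 => st_t; have t_le x : x \in t -> x <= N.
  by rewrite (mem_stirling _ st_t) => /andP[].
move: st_t; rewrite is_stirlingS -/N => /and3P[t_perm t_betw t_old].
have N2 : count_mem N t = 2.
  rewrite (permP t_perm) count_cat /= eqxx /= (count_memPn _) //.
  by rewrite mem_pairs_upto ltnn andbF.
have Nt : N \in t by rewrite -has_pred1 has_count N2.
have [a [u [def_t Na]]] := split_first Nt.
have Nu : N \in u.
  move: N2; rewrite def_t count_cat (count_memPn Na) /= eqxx add0n add1n.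
  by case=> N1; rewrite -has_pred1 has_count N1.
have [b [c [def_u Nb]]] := split_first Nu.
have b0 : b = [::].
  move: t_betw t_le; rewrite def_t def_u between_split //.
  case: b Nb {def_u} => // x b; rewrite inE negb_or => /andP[Nx _].
  move=> /= /andP[le_x _] /(_ x); rewrite mem_cat !inE eqxx !orbT => /(_ isT).
  lia.
have {Na Nb def_t def_u b0} def_t : t = insert_pair N (a ++ c) (size a).
  by rewrite def_t def_u b0 /insert_pair take_size_cat // drop_size_cat.
have ac_perm : perm_eq (a ++ c) (pairs_upto n).
  rewrite -(perm_cat2r [:: N; N]); apply: perm_trans t_perm; rewrite def_t.
  by rewrite perm_sym perm_insert_pair.
have Nac : N \notin a ++ c by rewrite (perm_mem ac_perm) mem_pairs_upto ltnn andbF.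
exists (a ++ c), (size a); split=> //.
  by apply/andP; split=> //; move: t_old; rewrite def_t filter_insert_pair.
by rewrite -size_pairs_upto -(perm_size ac_perm) size_cat leq_addr.
Qed.

Fixpoint stirling_seqs (n : nat) : seq (seq nat) :=
  if n is m.+1 then
    [seq insert_pair m.+1 s j | s <- stirling_seqs m, j <- iota 0 (2 * m).+1]
  else [:: [::]].

Lemma stirling_seqsS (n : nat) : stirling_seqs n.+1 =
  [seq insert_pair n.+1 s j | s <- stirling_seqs n, j <- iota 0 (2 * n).+1].
Proof. by []. Qed.

Lemma mem_stirling_seqs (n : nat) : stirling_seqs n =i is_stirling n.
Proof.
elim: n => [|n IHn] t.
  rewrite inE unfold_in /is_stirling /= andbT.
  by apply/eqP/idP => [-> // | /perm_nilP].
rewrite stirling_seqsS; apply/allpairsP/idP => [[[s j] /= [/[!IHn] st_s _ ->]] | st_t].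
  exact: stirling_insert.
have [s [j [st_s le_j ->]]] := stirling_remove st_t.
by exists (s, j); rewrite IHn mem_iota; split.
Qed.

(** Deleting the largest letter from a child recovers its parent, and the
    position of that letter recovers the gap of insertion. *)
Lemma stirling_seqs_uniq (n : nat) : uniq (stirling_seqs n).
Proof.
elim: n => // n IHn; rewrite stirling_seqsS; apply: allpairs_uniq => //; first exact: iota_uniq.
have old s : s \in stirling_seqs n -> n.+1 \notin s /\ size s = 2 * n.
  rewrite mem_stirling_seqs => st_s.
  by rewrite (mem_stirling _ st_s) ltnn andbF (size_stirling st_s).
move=> p q /allpairsP[[s i] [ss + ->]] /allpairsP[[s' i'] [ss' + ->]] /=.
rewrite !mem_iota => lt_i lt_i' eq_ss'.
have [/= Ns sz_s] := old _ ss; have [/= Ns' sz_s'] := old _ ss'.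
have <- : s = s'.
  by rewrite -(filter_insert_pair i Ns) eq_ss' filter_insert_pair.
congr (_, _); rewrite -(@index_insert_pair n.+1 s i) ?sz_s // eq_ss'.
by rewrite index_insert_pair ?sz_s'.
Qed.

Lemma desE (s : seq nat) :
  des s = count (fun i => nth 0 s i.+1 < nth 0 s i) (iota 0 (size s)).
Proof. by apply: eq_count => i; rewrite !nth_rcons_default. Qed.

(** The default 0 of head stands for the entry that follows the last one. *)
Lemma des_cons (x : nat) (s : seq nat) :
  des (x :: s) = (head 0 s < x) + des s.
Proof.
rewrite !desE /= nth0; congr (_ + _).
by rewrite (iotaDl 1 0) count_map; apply: eq_count.
Qed.

Lemma des_le_size (s : seq nat) : des s <= size s.
Proof. by rewrite desE (leq_trans (count_size _ _)) ?size_iota. Qed.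

(** The block N N contributes one descent, to its right.  It destroys the
    descent of the gap in which it is inserted, if there was one; the gap in
    front of the word never is a descent. *)
Lemma des_insert_pair (N : nat) (s : seq nat) (j : nat) :
  0 < N -> all (gtn N) s -> j <= size s ->
  des (insert_pair N s j) =
  des s + ((j == 0) || (nth 0 s j.-1 <= nth 0 s j)).
Proof.
move=> N_gt0; rewrite /insert_pair; elim: s j => [|x s IHs] [|j] //=.
- by rewrite !des_cons /= N_gt0 ltnn.
- by move=> /andP[lt_x _] _; rewrite !des_cons /= lt_x ltnn add0n addnC.
move=> /andP[lt_x lt_s] le_j; rewrite !des_cons IHs // -addnA.
case: j le_j => [|j] le_j /=.
  by rewrite take0 /= nth0 ltnNge (ltnW lt_x) /= add0n; lia.
case: s {IHs} lt_s le_j => //= y s _ _; lia.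
Qed.

(** Among the 2 n + 1 gaps of s, the des s descents keep the statistic and the
    others raise it by one: this is the action of the recurrence operator. *)
Lemma sum_insert_pair (n : nat) (s : seq nat) : is_stirling n s ->
  (\sum_(j <- iota 0 (2 * n).+1) 'X^(des (insert_pair n.+1 s j)) =
   eulerian_step n 'X^(des s))%R.
Proof.
move=> st_s; have sz_s := size_stirling st_s.
have lt_s : all (gtn n.+1) s.
  by apply/allP => x; rewrite (mem_stirling _ st_s) => /andP[].
have le_des : des s <= 2 * n by rewrite -sz_s des_le_size.
rewrite -[X in eulerian_step _ X]scale1r eulerian_step_monomial; last exact: leqW.
rewrite !mul1r [iota 0 _]/= big_cons.
rewrite des_insert_pair //= (iotaDl 1 0) big_map addn1.
rewrite (eq_big_seq (fun j => if (nth 0 s j.+1 < nth 0 s j)%N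
   then 'X^(des s) else 'X^((des s).+1) : {poly int}))%R; last first.
  move=> j; rewrite mem_iota => lt_j.
  by rewrite des_insert_pair ?sz_s //= leqNgt; case: ifP => _; rewrite ?addn0 ?addn1.
rewrite (bigID (fun j => nth 0 s j.+1 < nth 0 s j)) /= addrCA.
congr (_ + _)%R.
  rewrite (eq_bigr (fun=> 'X^(des s)%R)) => [|j ->//].
  by rewrite big_const_seq iter_addr addr0 -scaler_nat desE sz_s.
rewrite (eq_bigr (fun=> 'X^((des s).+1)%R)) => [|j /negPf -> //].
rewrite big_const_seq iter_addr addr0 scaler_nat -mulrS; congr (_ *+ _)%R.
have := count_predC (fun j => nth 0 s j.+1 < nth 0 s j) (iota 0 (2 * n)).
rewrite size_iota -{1}sz_s -desE => def_n.
by rewrite -[X in X.+1 - _]def_n -addnS addKn.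
Qed.

Lemma stirling_sumS (n : nat) :
  (\sum_(s <- stirling_seqs n.+1) 'X^(des s) =
   eulerian_step n (\sum_(s <- stirling_seqs n) 'X^(des s)))%R.
Proof.
rewrite stirling_seqsS big_allpairs_dep eulerian_step_sum.
by apply: eq_big_seq => s; rewrite mem_stirling_seqs => /sum_insert_pair.
Qed.

Lemma second_order_eulerianE (n : nat) :
  (second_order_eulerian n = \sum_(s <- stirling_seqs n) 'X^(des s))%R.
Proof.
rewrite /second_order_eulerian.
rewrite -(@sum_finset_list _ _ _ (@word n (2 * n)) (is_stirling n)
   (stirling_seqs n) (fun s => 'X^(des s)%R)).
- by apply: eq_bigl => s; rewrite inE.
- by move=> s t /(inj_map val_inj)/val_inj.
- exact: stirling_seqs_uniq.
- exact: mem_stirling_seqs.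
move=> s st_s; have sz_s : size (map (@inord n) s) == 2 * n.
  by rewrite size_map (size_stirling st_s).
exists (Tuple sz_s); rewrite /word /= -map_comp -[RHS]map_id.
apply/eq_in_map => x; rewrite (mem_stirling _ st_s) => /andP[_ le_x] /=.
by rewrite inordK.
Qed.

(** * Columns of a tableau *)

Lemma ltn_sorted (s : seq nat) : sorted ltn s = pairwise ltn s.
Proof. exact: (sorted_pairwise ltn_trans). Qed.

Lemma geq_sorted (s : seq nat) : sorted geq s = pairwise geq s.
Proof.
by apply: sorted_pairwise => a b c /= le_ab le_ca; apply: leq_trans le_ca le_ab.
Qed.

Lemma column_cat (k : nat) (A B : tableau) :
  column k (A ++ B) = column k A ++ column k B.
Proof. by rewrite /column filter_cat map_cat. Qed.

Lemma column_nil (k : nat) (T : tableau) :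
  all (fun r => size r < k) T -> column k T = [::].
Proof.
move=> T_lt; rewrite /column -(@eq_in_filter _ pred0) ?filter_pred0 // => r Tr.
by have /= := allP T_lt r Tr; rewrite ltnNge => /negPf.
Qed.

Definition nonempty (r : seq nat) : bool := r != [::].

Lemma column_nonempty (k : nat) (T : tableau) : 0 < k ->
  column k (filter nonempty T) = column k T.
Proof.
move=> k_gt0; rewrite /column -filter_predI; congr map.
by apply: eq_filter => -[|x r] /=; rewrite ?andbT //; case: k k_gt0.
Qed.

Lemma flatten_nonempty (T : tableau) : flatten (filter nonempty T) = flatten T.
Proof. by elim: T => [|[|x r] T IHT] //=; rewrite IHT. Qed.

Lemma all_nonempty (p : pred (seq nat)) (T : tableau) : p [::] ->
  all p (filter nonempty T) = all p T.
Proof. by move=> p0; elim: T => [|[|x r] T IHT] //=; rewrite ?p0 IHT. Qed.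

Lemma size_row_flatten (T : tableau) (r : seq nat) :
  r \in T -> size r <= size (flatten T).
Proof.
elim: T => //= r' T IHT; rewrite inE size_cat.
case/predU1P => [-> | /IHT le_r]; first exact: leq_addr.
by rewrite (leq_trans le_r) ?leq_addl.
Qed.

(** The columns beyond the n-th are empty, so the column condition may be
    required for all positive k, which makes it independent of n. *)
Lemma sytP (n : nat) (T : tableau) :
  reflect [/\ sorted geq (shape T), all nonempty T,
              perm_eq (flatten T) (iota 1 n), all (sorted ltn) T
            & forall k, 0 < k -> sorted ltn (column k T)]
          (is_syt n T).
Proof.
have nonemptyE : (0 \notin shape T) = all nonempty T.
  elim: T => //= r T <-; rewrite /shape /= inE negb_or.
  by rewrite eq_sym size_eq0.
apply: (iffP and4P) => [[/and3P[sh_T T0 _] T_perm T_rows T_cols]|].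
  split; rewrite -?nonemptyE // => k k_gt0.
  have [le_k | lt_k] := leqP k n; first by apply: (allP T_cols); rewrite mem_iota; lia.
  rewrite column_nil //; apply/allP => r Tr; apply: leq_trans lt_k.
  rewrite ltnS -(size_iota 1 n) -(perm_size T_perm).
  exact: size_row_flatten.
case=> sh_T T0 T_perm T_rows T_cols; split=> //.
  rewrite /is_partition_of sh_T nonemptyE T0 /=.
  by rewrite -size_flatten (perm_size T_perm) size_iota.
by apply/allP => k; rewrite mem_iota => /andP[k_gt0 _]; apply: T_cols.
Qed.

(** * Growing a tableau by one box *)

(** As the rows of a tableau are nonempty, k = 0 encodes the creation of a new
    row at the top.  For k > 0 only the first row of length k can be extended
    without destroying the shape, so k determines the box that is added. *)
Fixpoint grow (N k : nat) (T : tableau) : tableau :=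
  if T is r :: T' then
    if size r == k then rcons r N :: T' else r :: grow N k T'
  else [:: [:: N]].

Lemma grow_cat (N k : nat) (A B : tableau) :
  all (fun r => size r != k) A -> grow N k (A ++ B) = A ++ grow N k B.
Proof. by elim: A => //= r A IHA /andP[/negPf -> /IHA ->]. Qed.

Lemma size_grow (N k : nat) (T : tableau) : k \in 0 :: shape T ->
  all nonempty T -> size (grow N k T) = size T + (k == 0).
Proof.
elim: T => [|r T IHT] /=; first by rewrite inE => ->.
move=> k_in /andP[r0 T0]; case: eqP => [def_k | /eqP rk] /=.
  by rewrite -def_k size_eq0 (negPf r0) addn0.
rewrite IHT //; move: k_in; rewrite !inE (eq_sym k (size r)) (negPf rk).
by [].
Qed.

Lemma perm_flatten_grow (N k : nat) (T : tableau) :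
  perm_eq (flatten (grow N k T)) (N :: flatten T).
Proof.
elim: T => //= r T IHT; case: ifP => _ /=.
  by rewrite -cats1 -catA perm_catCA.
rewrite -(cat1s N (_ ++ _)) perm_sym perm_catCA perm_cat2l /=.
by rewrite perm_sym.
Qed.

Lemma restrict_cons (i : nat) (r : seq nat) (T : tableau) :
  restrict i (r :: T) =
  if nonempty [seq a <- r | a <= i]
  then [seq a <- r | a <= i] :: restrict i T else restrict i T.
Proof. by []. Qed.

Lemma restrict_id (n : nat) (T : tableau) :
  all nonempty T -> all (fun a => a <= n) (flatten T) -> restrict n T = T.
Proof.
elim: T => // r T IHT /= /andP[r0 T0]; rewrite all_cat => /andP[r_le T_le].
by rewrite restrict_cons (all_filterP r_le) r0 IHT.
Qed.

Lemma restrict_restrict (i n : nat) (T : tableau) : i <= n ->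
  restrict i (restrict n T) = restrict i T.
Proof.
move=> le_in; elim: T => // r T IHT; rewrite !restrict_cons.
have le_filter : [seq a <- [seq a <- r | a <= n] | a <= i] = [seq a <- r | a <= i].
  rewrite -filter_predI; apply: eq_filter => a /=.
  by case: (leqP a i) => //= le_ai; apply: leq_trans le_in.
case: ifP => [_ | /negbFE/eqP r0]; first by rewrite restrict_cons le_filter IHT.
by rewrite -le_filter r0 IHT.
Qed.

(** This is how a parent is read off its child. *)
Lemma restrict_grow (n k : nat) (T : tableau) :
  all nonempty T -> all (fun a => a <= n) (flatten T) ->
  restrict n (grow n.+1 k T) = T.
Proof.
elim: T => [|r T IHT]; first by rewrite /restrict /= ltnn.
move=> /= /andP[r0 T0]; rewrite all_cat => /andP[r_le T_le].
case: ifP => _; rewrite restrict_cons ?filter_rcons ?ltnn (all_filterP r_le) r0.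
  by rewrite restrict_id.
by rewrite IHT.
Qed.

Lemma col_index_cons (i : nat) (r : seq nat) (T : tableau) :
  col_index i (r :: T) = if i \in r then (index i r).+1 else col_index i T.
Proof. by rewrite /col_index /=; case: ifP. Qed.

Lemma col_index_grow_old (N i k : nat) (T : tableau) : i != N ->
  i \in flatten T -> col_index i (grow N k T) = col_index i T.
Proof.
move=> iN; elim: T => //= r T IHT; rewrite mem_cat => i_in.
case: ifP => _; rewrite !col_index_cons.
  by rewrite mem_rcons inE (negPf iN) -cats1 index_cat; case: (i \in r).
by case: ifP i_in => // _ /IHT.
Qed.

Lemma col_index_grow_new (N k : nat) (T : tableau) : k \in 0 :: shape T ->
  N \notin flatten T -> col_index N (grow N k T) = k.+1.
Proof.
elim: T => [|r T IHT] /=.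
  by rewrite inE => /eqP -> _; rewrite col_index_cons inE /= eqxx.
rewrite mem_cat negb_or => k_in /andP[Nr NT]; case: eqP => [rk | /eqP rk].
  rewrite col_index_cons mem_rcons inE eqxx -cats1 index_cat (negPf Nr) /=.
  by rewrite eqxx addn0 rk.
rewrite col_index_cons (negPf Nr) IHT //.
by move: k_in; rewrite !inE (eq_sym k (size r)) (negPf rk).
Qed.

Lemma colE (k : nat) (T : tableau) :
  Defs.col k T = count (fun r => k <= size r) T.
Proof. by rewrite /Defs.col /column size_map size_filter. Qed.

(** Explicit form of grow.  When k = 0 the row that grows is an empty row r put
    on top of T, which is why T is recovered only after discarding the empty
    rows; this treats both kinds of growth at once. *)
Lemma grow_decomp (N k : nat) (T : tableau) :
  sorted geq (shape T) -> all nonempty T -> k \in 0 :: shape T ->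
  exists A r B, [/\ T = filter nonempty (A ++ r :: B),
    sorted geq (shape (A ++ r :: B)), size r = k,
    [/\ all (fun r' => k < size r') A, all (fun r' => size r' <= k) B
       & all nonempty B] &
    grow N k T = A ++ rcons r N :: B].
Proof.
rewrite geq_sorted => sh_T T0 k_in.
have [->|k_neq0] := eqVneq k 0.
  exists T, [::], [::]; split=> //.
  - by rewrite filter_cat /= cats0 (all_filterP T0).
  - rewrite geq_sorted /shape map_cat pairwise_cat sh_T /= !andbT.
    by apply/allrelP => a b _; rewrite inE => /eqP ->.
  - by split=> //; apply: sub_all T0 => -[].
  rewrite -[in LHS](cats0 T) grow_cat //.
  by apply: sub_all T0 => r; rewrite size_eq0.
have {k_in} /mapP[r0 Tr0 r0k] : k \in shape T.
  by move: k_in; rewrite inE (negPf k_neq0).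
have : has (fun r => size r == k) T by apply/hasP; exists r0; rewrite // r0k.
move=> T_has; case/split_find: T_has sh_T T0 => r A B /eqP rk.
rewrite -all_predC cat_rcons => A_neq sh_T T0.
have B0 : all nonempty B.
  by move: T0; rewrite all_cat /= => /and3P[].
exists A, r, B; split; rewrite ?geq_sorted ?(all_filterP T0) //; last first.
  by rewrite grow_cat //= rk eqxx.
move: sh_T; rewrite /shape map_cat pairwise_cat /= rk.
case/and4P=> /allrelP A_ge _ /allP B_le _.
split=> //; apply/allP => r' r'in.
  have /= := allP A_neq r' r'in.
  have /= := A_ge (size r') k (map_f _ r'in) (mem_head _ _).
  by rewrite ltn_neqAle eq_sym => -> ->.
by apply: B_le; apply: map_f.
Qed.

Lemma sorted_geq_insert (a b : seq nat) (k m : nat) :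
  all (leq m) a -> all (geq m) b -> sorted geq (a ++ k :: b) ->
  sorted geq (a ++ m :: b).
Proof.
rewrite !geq_sorted !pairwise_cat /= !allrel_consr => a_ge b_le.
by case/and4P=> /andP[_ ->] -> _ ->; rewrite a_ge b_le.
Qed.

(** Only column k+1, where k is the length of the row that grows, is changed;
    the rows above being at most as long, the new entry is the last of it. *)
Lemma column_grown (j N : nat) (A B : tableau) (r : seq nat) :
  0 < j -> all (fun r' => size r < size r') A ->
  all (fun r' => size r' <= size r) B ->
  column j (A ++ rcons r N :: B) =
  if j == (size r).+1 then rcons (column j (A ++ r :: B)) N
  else column j (A ++ r :: B).
Proof.
move=> j_gt0 A_gt B_le; rewrite -(cat1s (rcons r N)) -(cat1s r) !column_cat.
case: (ltngtP j (size r).+1) => [lt_j | gt_j | ->].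
- congr (_ ++ (_ ++ _)); rewrite /column /= size_rcons (ltnW lt_j).
  by rewrite -ltnS lt_j /= nth_rcons; case: j j_gt0 lt_j => //= j _; rewrite ltnS => ->.
- congr (_ ++ (_ ++ _)); rewrite /column /= size_rcons.
  by rewrite leqNgt gt_j leqNgt (ltnW gt_j).
rewrite (column_nil (T := B)); last by apply: sub_all B_le => r'; rewrite ltnS.
rewrite !cats0 -[RHS]cats1 -catA; congr (_ ++ _).
by rewrite /column /= size_rcons leqnn ltnn /= nth_rcons ltnn eqxx.
Qed.

Lemma syt_mem (n i : nat) (T : tableau) : is_syt n T ->
  (i \in flatten T) = (0 < i <= n).
Proof. by case/sytP=> _ _ /perm_mem -> _ _; rewrite mem_iota. Qed.

Lemma mem_column (k i : nat) (T : tableau) : 0 < k ->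
  i \in column k T -> i \in flatten T.
Proof.
move=> k_gt0 /mapP[r]; rewrite mem_filter => /andP[le_k Tr] ->.
by apply/flattenP; exists r => //; apply: mem_nth; case: k k_gt0 le_k.
Qed.

Lemma sorted_ltn_rcons (s : seq nat) (N : nat) :
  sorted ltn (rcons s N) = all (gtn N) s && sorted ltn s.
Proof. by rewrite !ltn_sorted pairwise_rcons. Qed.

Lemma perm_iota1S (n : nat) (s t : seq nat) :
  perm_eq t (n.+1 :: s) -> perm_eq t (iota 1 n.+1) = perm_eq s (iota 1 n).
Proof.
by move=> /permPl ->; rewrite iota1S cats1 perm_sym perm_rcons perm_cons perm_sym.
Qed.

(** The row that grows is the first of its length, so the rows below are longer
    and the shape remains a partition; and the new entry exceeds all others,
    so the end of its row and of its column is a legal place for it. *)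
Lemma syt_grow (n k : nat) (T : tableau) : is_syt n T ->
  k \in 0 :: shape T -> is_syt n.+1 (grow n.+1 k T).
Proof.
move=> syt_T k_in; have T_mem i := syt_mem i syt_T.
have [sh_T T0 T_perm T_rows T_cols] := sytP _ _ syt_T.
have perm_g : perm_eq (flatten (grow n.+1 k T)) (iota 1 n.+1).
  by rewrite (perm_iota1S (perm_flatten_grow _ _ _)).
have [A [r [B [def_T sh_ArB rk [A_gt B_le B0] def_g]]]] :=
  grow_decomp n.+1 sh_T T0 k_in.
have T_rows' : all (sorted ltn) (A ++ r :: B).
  by rewrite -all_nonempty // -def_T.
have ArB_mem i : i \in flatten (A ++ r :: B) -> i < n.+1.
  by rewrite -flatten_nonempty -def_T T_mem => /andP[].
have r_lt : all (gtn n.+1) r.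
  apply/allP => i ri; apply: ArB_mem; apply/flattenP; exists r => //.
  by rewrite mem_cat mem_head orbT.
have A0 : all nonempty A by apply: sub_all A_gt => -[].
apply/sytP; rewrite def_g in perm_g *; split=> //.
- move: sh_ArB; rewrite /shape !map_cat /= size_rcons rk.
  apply: sorted_geq_insert; rewrite all_map //.
  by apply: sub_all B_le => r' /= /leqW.
- by rewrite all_cat A0 /= B0 andbT; case: (r).
- move: T_rows'; rewrite !all_cat /= => /and3P[-> r_sorted ->].
  by rewrite sorted_ltn_rcons r_lt r_sorted.
move=> j j_gt0; have := T_cols j j_gt0; rewrite def_T column_nonempty // => colj.
rewrite column_grown ?rk //; case: ifP => // _.
rewrite sorted_ltn_rcons colj andbT; apply/allP => i /(mem_column j_gt0).
exact: ArB_mem.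
Qed.

(** The largest entry N is the last of its row, and no row above reaches its
    column, since the entries there would exceed N.  So all rows above are at
    most as long as the row deprived of N, and all rows below are longer,
    whence that row is the first of its length. *)
Lemma syt_shrink (n : nat) (t : tableau) : is_syt n.+1 t ->
  exists T k, [/\ is_syt n T, k \in 0 :: shape T & t = grow n.+1 k T].
Proof.
set N := n.+1 => syt_t; have t_mem i := syt_mem i syt_t.
have [sh_t t0 t_perm t_rows t_cols] := sytP _ _ syt_t.
have /flattenP[r' tr' Nr'] : N \in flatten t by rewrite t_mem leqnn.
have [A [B [def_t _]]] := split_first tr'.
have r'_le i : i \in r' -> i <= N.
  move=> r'i; suff : i \in flatten t by rewrite t_mem => /andP[].
  by apply/flattenP; exists r'.
have r'_sorted := allP t_rows r' tr'.
have [r def_r'] : exists r, r' = rcons r N.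
  case/lastP: r' {def_t tr'} Nr' r'_le r'_sorted => // r x Nrx r_le.
  rewrite sorted_ltn_rcons => /andP[/allP r_lt _]; exists r; congr rcons.
  move: Nrx; rewrite mem_rcons inE => /predU1P[// | /r_lt /= lt_x].
  by have := r_le x; rewrite mem_rcons mem_head => /(_ isT); lia.
rewrite {}def_r' {r' Nr' r'_le tr'} in def_t r'_sorted; subst t.
set k := size r.
have A_gt : all (fun a => k < size a) A.
  move: sh_t; rewrite geq_sorted /shape map_cat pairwise_cat.
  case/andP=> /allrelP A_ge _; apply/allP => a Aa.
  by have := A_ge (size a) k.+1; apply; rewrite ?map_f //= size_rcons mem_head.
(* A longer row above would have an entry above N in column k+1. *)
have B_le : all (fun b => size b <= k) B.
  apply/allP => b Bb; rewrite leqNgt; apply/negP => lt_k.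
  have := t_cols k.+1 isT; rewrite column_cat -cat1s column_cat.
  rewrite {2}/column /= size_rcons leqnn /= nth_rcons ltnn eqxx.
  rewrite ltn_sorted pairwise_cat /= => /and3P[_ _ /andP[/allP colB_gt _]].
  have colB_b : nth 0 b k \in column k.+1 B.
    by apply/mapP; exists b; rewrite // mem_filter lt_k.
  have := t_mem (nth 0 b k); have /= := colB_gt _ colB_b.
  rewrite flatten_cat mem_cat /= mem_cat (mem_column _ colB_b) ?orbT //; lia.
have [A0 B0] : all nonempty A /\ all nonempty B.
  by move: t0; rewrite all_cat /= => /and3P[].
pose T := filter nonempty (A ++ r :: B).
exists T, k; split.
- apply/sytP; split; rewrite ?filter_all //.
  + rewrite geq_sorted /shape pairwise_map; apply: pairwise_filter.
    rewrite -pairwise_map -geq_sorted map_cat; move: sh_t.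
    rewrite /shape map_cat /= size_rcons; apply: sorted_geq_insert.
      by rewrite all_map; apply: sub_all A_gt => a /ltnW.
    by rewrite all_map.
  + rewrite flatten_nonempty.
    rewrite -(perm_iota1S (t := flatten (A ++ rcons r N :: B))) //.
    apply/permP => p; rewrite !flatten_cat /= -cats1 !(count_cat, flatten_cat) /=.
    by rewrite -/N; lia.
  + rewrite all_nonempty //; move: t_rows; rewrite !all_cat /=.
    by rewrite sorted_ltn_rcons => /and3P[-> /andP[_ ->] ->].
  move=> j j_gt0; rewrite column_nonempty //; have := t_cols j j_gt0.
  by rewrite column_grown //; case: ifP => // _; rewrite sorted_ltn_rcons => /andP[].
- have [r0 | r0] := boolP (nonempty r); last by rewrite inE /k; case: (r) r0.
  rewrite inE; apply/orP; right; apply: (map_f size).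
  by rewrite mem_filter r0 mem_cat mem_head orbT.
rewrite /T filter_cat (all_filterP A0) grow_cat; last first.
  by apply: sub_all A_gt => a; rewrite neq_ltn orbC => ->.
congr (_ ++ _); rewrite /= (all_filterP B0).
(* If N is alone in its row, the rows above have length at most 0: there are
   none, and the growth step is the creation of the top row. *)
case: ifP => r0; first by rewrite /= eqxx.
have r_nil : r = [::] by case: (r) r0.
move: B_le B0; rewrite /k r_nil; case: (B) => //= b B' /andP[].
by case: b.
Qed.

(** * The weight of a growth step *)

Lemma count_size_grow (N k j : nat) (T : tableau) : 0 < j ->
  k \in 0 :: shape T ->
  count (fun r => j <= size r) (grow N k T) =
  count (fun r => j <= size r) T + (j == k.+1).
Proof.
move=> j_gt0; elim: T => [|r T IHT] /=; first by rewrite inE => /eqP ->; lia.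
move=> k_in; case: eqP => [rk | /eqP rk] /=; first by rewrite size_rcons; lia.
rewrite IHT ?addnA //.
by move: k_in; rewrite !inE (eq_sym k (size r)) (negPf rk).
Qed.

(** The box sorting index of the box being added, read from the smaller
    tableau: for k > 0 the difference of two successive column heights is the
    number of rows of length exactly k. *)
Definition growth_weight (n k : nat) (T : tableau) : nat :=
  if k == 0 then n.+1 - size T else count_mem k (shape T).

Lemma syt_size_le (n : nat) (T : tableau) : is_syt n T -> size T <= n.
Proof.
case/sytP=> _ T0 T_perm _ _.
rewrite -(size_iota 1 n) -(perm_size T_perm) size_flatten.
elim: T T0 {T_perm} => //= -[|x r] T IHT //= T0.
by rewrite addSn ltnS (leq_trans (IHT T0)) ?leq_addl.
Qed.

Lemma box_sorting_index_grow_new (n k : nat) (T : tableau) : is_syt n T ->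
  k \in 0 :: shape T ->
  box_sorting_index n.+1 (grow n.+1 k T) = (growth_weight n k T)%:R%R.
Proof.
move=> syt_T k_in; have [_ T0 T_perm _ _] := sytP _ _ syt_T.
have [_ g0 g_perm _ _] := sytP _ _ (syt_grow syt_T k_in).
have -> : box_sorting_index n.+1 (grow n.+1 k T) =
  (if k == 0%N then n.+1%:Z - (Defs.col 1 (grow n.+1 k T))%:Z + 1
   else (Defs.col k (grow n.+1 k T))%:Z - (Defs.col k.+1 (grow n.+1 k T))%:Z + 1)%R.
  rewrite /box_sorting_index col_index_grow_new //; last first.
    by rewrite (syt_mem _ syt_T) ltnn andbF.
  rewrite restrict_id //; apply/allP => i.
  by rewrite (perm_mem g_perm) mem_iota => /andP[].
rewrite !colE /growth_weight natz; case: eqP => [k0 | /eqP k_neq0].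
  have le_n := syt_size_le syt_T.
  rewrite count_size_grow // k0 /=.
  have -> : count (fun r => 0 < size r) T = size T.
    by apply/eqP; rewrite -all_count; apply: sub_all T0 => -[].
  lia.
rewrite !count_size_grow ?lt0n // eqxx.
have -> : count (fun r => k <= size r) T =
    count (fun r => k < size r) T + count_mem k (shape T).
  rewrite /shape count_map; elim: (T) => //= r T' ->.
  by rewrite addnACA leq_eqVlt (eq_sym k); case: ltngtP.
lia.
Qed.

(** The box sorting index of i only depends on the entries at most i, which the
    growth does not move. *)
Lemma box_sorting_index_grow_old (n k i : nat) (T : tableau) : is_syt n T ->
  0 < i <= n -> box_sorting_index i (grow n.+1 k T) = box_sorting_index i T.
Proof.
move=> syt_T i_in; have [_ T0 _ _ _] := sytP _ _ syt_T.
rewrite /box_sorting_index col_index_grow_old ?(syt_mem _ syt_T) //; last lia.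
have /andP[_ le_i] := i_in.
rewrite -(restrict_restrict _ le_i) restrict_grow //.
by apply/allP => a; rewrite (syt_mem _ syt_T) => /andP[].
Qed.

Definition syt_weight (n : nat) (T : tableau) : int :=
  (\prod_(1 <= i < n.+1)
     (box_sorting_index i T * (i`!)%:R ^+ rows_of_size i T))%R.

(** Grouping the rows by length turns the product of the (i!)^(w_i) into a
    product over rows, which follows the growth of one row easily. *)
Lemma prod_factorials (n : nat) (T : tableau) :
  all (fun r => 0 < size r <= n) T ->
  (\prod_(1 <= i < n.+1) (i`!%:R : int) ^+ rows_of_size i T =
   \prod_(r <- T) (size r)`!%:R)%R.
Proof.
elim: T => [|r T IHT] /=; first by rewrite big_nil big1.
case/andP=> r_le T_le; rewrite big_cons -IHT //.
rewrite /rows_of_size /=; under eq_bigr do rewrite exprD.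
rewrite big_split /=; congr (_ * _)%R.
rewrite (bigD1_seq (size r)) ?mem_index_iota ?iota_uniq //= eqxx expr1.
by rewrite big1 ?mulr1 // => i; rewrite eq_sym => /negPf ->.
Qed.

Lemma prod_factorials_grow (N k : nat) (T : tableau) : k \in 0 :: shape T ->
  (\prod_(r <- grow N k T) (size r)`!%:R =
   k.+1%:R * \prod_(r <- T) (size r)`!%:R :> int)%R.
Proof.
elim: T => [|r T IHT] /=.
  by rewrite inE => /eqP ->; rewrite big_cons.
move=> k_in; case: eqP => [rk | /eqP rk].
  by rewrite !big_cons size_rcons rk factS natrM mulrA.
rewrite !big_cons IHT; first by rewrite mulrCA.
by move: k_in; rewrite !inE (eq_sym k (size r)) (negPf rk).
Qed.

Lemma syt_weightE (n : nat) (T : tableau) : is_syt n T ->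
  (syt_weight n T = (\prod_(1 <= i < n.+1) box_sorting_index i T) *
     \prod_(r <- T) (size r)`!%:R)%R.
Proof.
case/sytP=> _ T0 T_perm _ _; rewrite /syt_weight big_split /=.
congr (_ * _)%R; apply: prod_factorials; apply/allP => r Tr.
have := allP T0 r Tr; rewrite /nonempty -size_eq0 -lt0n => ->.
by rewrite -(size_iota 1 n) -(perm_size T_perm) size_row_flatten.
Qed.

(** The factor k+1 comes from the row that grows, whose factorial goes from k!
    to (k+1)!. *)
Lemma syt_weight_grow (n k : nat) (T : tableau) : is_syt n T ->
  k \in 0 :: shape T ->
  (syt_weight n.+1 (grow n.+1 k T) =
   (growth_weight n k T * k.+1)%:R * syt_weight n T)%R.
Proof.
move=> syt_T k_in; have syt_g := syt_grow syt_T k_in.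
rewrite !syt_weightE // prod_factorials_grow // big_nat_recr //=.
rewrite box_sorting_index_grow_new // natrM.
rewrite (eq_big_nat _ _ (F2 := fun i => box_sorting_index i T)); first by ring.
by move=> i i_in; apply: box_sorting_index_grow_old.
Qed.

(** Only the first row of length k grows, but its index counts all rows of that
    length, so that in effect each row contributes its length plus one. *)
Lemma sum_growth_weight (T : tableau) :
  \sum_(k <- undup (shape T)) count_mem k (shape T) * k.+1 =
  size (flatten T) + size T.
Proof.
have := big_undup_iterop_count addn (shape T) xpredT S => /=.
under eq_bigr do rewrite Monoid.iteropE -/(iter _ _ _) iter_addn_0 mulnC.
move=> ->; rewrite size_flatten /shape.
by elim: T => [|r T IHT]; rewrite ?big_nil //= big_cons IHT; lia.
Qed.

Definition syt_term (n : nat) (T : tableau) : {poly int} :=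
  (syt_weight n T *: 'X^(n + 1 - nrows T))%R.

(** Put p = n + 1 - l for a tableau with l rows.  A new row keeps the exponent p
    and has weight p; lengthening a row raises the exponent, with total weight
    the sum of (length + 1) over the rows, n + l = 2 n + 1 - p.  These are the
    two terms of the recurrence operator applied to x^p. *)
Lemma sum_grow (n : nat) (T : tableau) : is_syt n T ->
  (\sum_(k <- 0%N :: undup (shape T)) syt_term n.+1 (grow n.+1 k T) =
   eulerian_step n (syt_term n T))%R.
Proof.
move=> syt_T; have le_n := syt_size_le syt_T.
have [_ T0 T_perm _ _] := sytP _ _ syt_T.
rewrite big_cons /syt_term eulerian_step_monomial; last by rewrite /nrows; lia.
congr (_ + _)%R.
  rewrite syt_weight_grow ?mem_head // /nrows size_grow ?mem_head //.
  rewrite muln1 mulrC /growth_weight /=.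
  by congr ((_ * _%:R) *: 'X^_)%R; lia.
have neq0 k : k \in shape T -> k != 0.
  by case/mapP=> r Tr ->; rewrite size_eq0; apply: (allP T0).
rewrite (eq_big_seq (fun k => (syt_weight n T *
    (count_mem k (shape T) * k.+1)%N%:R) *: 'X^((n + 1 - nrows T).+1)))%R.
  rewrite -scaler_suml -mulr_sumr -natr_sum sum_growth_weight.
  rewrite (perm_size T_perm) size_iota.
  by congr ((_ * _%:R) *: _)%R; rewrite /nrows; lia.
move=> k; rewrite mem_undup => k_in; have k0 := neq0 k k_in.
have k_in' : k \in 0 :: shape T by rewrite inE k_in orbT.
rewrite syt_weight_grow // /nrows size_grow // (negPf k0) addn0.
rewrite /growth_weight (negPf k0) mulrC; congr (_ *: 'X^_)%R; lia.
Qed.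

(** * Generation of all standard Young tableaux *)

Fixpoint syt_seqs (n : nat) : seq tableau :=
  if n is m.+1 then
    [seq grow m.+1 k T | T <- syt_seqs m, k <- 0 :: undup (shape T)]
  else [:: [::]].

Lemma syt_seqsS (n : nat) : syt_seqs n.+1 =
  [seq grow n.+1 k T | T <- syt_seqs n, k <- 0 :: undup (shape T)].
Proof. by []. Qed.

Lemma mem_syt_seqs (n : nat) : syt_seqs n =i is_syt n.
Proof.
elim: n => [|n IHn] t.
  rewrite inE unfold_in; apply/eqP/sytP => [-> // | [_ t0 t_perm _ _]].
  by case: t t0 t_perm => //= r t /andP[r0 _]; case: r r0 => // x r _ /perm_nilP.
have mem_k k T : (k \in 0 :: undup (shape T)) = (k \in 0 :: shape T).
  by rewrite !inE mem_undup.
rewrite syt_seqsS; apply/allpairsPdep/idP => [[T [k [/[!IHn] syt_T + ->]]] | syt_t].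
  by rewrite mem_k; apply: syt_grow.
have [T [k [syt_T k_in ->]]] := syt_shrink syt_t.
by exists T, k; rewrite IHn mem_k.
Qed.

(** Deleting the largest entry recovers the parent, and the column of that
    entry recovers the length of the row that was extended. *)
Lemma syt_seqs_uniq (n : nat) : uniq (syt_seqs n).
Proof.
elim: n => // n IHn; rewrite syt_seqsS; apply: allpairs_uniq_dep => //.
  move=> T; rewrite mem_syt_seqs => /sytP[_ T0 _ _ _].
  rewrite /= undup_uniq mem_undup andbT; apply/mapP => -[r Tr] /esym/eqP.
  by rewrite size_eq0 (negPf (allP T0 r Tr)).
move=> p q /allpairsPdep[T [k [ss + ->]]] /allpairsPdep[T' [k' [ss' + ->]]] /=.
rewrite !inE !mem_undup -!in_cons => k_in k_in' eq_g.
move: ss ss'; rewrite !mem_syt_seqs => syt_T syt_T'.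
have grow_data U j : is_syt n U -> j \in 0 :: shape U ->
    restrict n (grow n.+1 j U) = U /\ col_index n.+1 (grow n.+1 j U) = j.+1.
  move=> syt_U j_in; have [_ U0 _ _ _] := sytP _ _ syt_U; split.
    by apply: restrict_grow => //; apply/allP => a; rewrite (syt_mem _ syt_U) => /andP[].
  by apply: col_index_grow_new; rewrite // (syt_mem _ syt_U) ltnn andbF.
have [rT cT] := grow_data T k syt_T k_in.
have [] := grow_data T' k' syt_T' k_in'.
by rewrite -eq_g rT cT => -> [->].
Qed.

Lemma rows_inj (n : nat) : injective (@rows n).
Proof.
by move=> S T /(inj_map (inj_comp (inj_map val_inj) val_inj))/val_inj.
Qed.

Lemma rows_surj (n : nat) (T : tableau) : is_syt n T ->
  exists U : n.-bseq (n.-bseq 'I_n.+1), rows U = T.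
Proof.
move=> syt_T; have [_ _ T_perm _ _] := sytP _ _ syt_T.
exists (insub_bseq n [seq insub_bseq n (map (@inord n) r) | r <- T]).
rewrite /rows [bseqval (insub_bseq _ _)]insubdK; last first.
  by rewrite unfold_in size_map syt_size_le.
rewrite -map_comp -[RHS]map_id; apply/eq_in_map => r Tr /=.
rewrite [bseqval (insub_bseq _ _)]insubdK; last first.
  rewrite unfold_in size_map -[leqRHS](size_iota 1 n) -(perm_size T_perm).
  exact: size_row_flatten.
rewrite -map_comp -[RHS]map_id; apply/eq_in_map => x rx /=.
rewrite inordK // ltnS; suff: x \in flatten T by rewrite (syt_mem _ syt_T) => /andP[].
by apply/flattenP; exists r.
Qed.

Lemma sum_SYT (n : nat) :
  (\sum_(T in SYT n) syt_term n (rows T) = \sum_(T <- syt_seqs n) syt_term n T)%R.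
Proof.
rewrite -(sum_finset_list _ (@rows_inj n) (syt_seqs_uniq n)
  (@mem_syt_seqs n) (@rows_surj n)).
by apply: eq_bigl => s; rewrite inE.
Qed.

Lemma syt_sumS (n : nat) :
  (\sum_(T <- syt_seqs n.+1) syt_term n.+1 T =
   eulerian_step n (\sum_(T <- syt_seqs n) syt_term n T))%R.
Proof.
rewrite syt_seqsS big_allpairs_dep eulerian_step_sum.
by apply: eq_big_seq => T; rewrite mem_syt_seqs => /sum_grow.
Qed.

(** * The identity *)

Local Open Scope ring_scope.

Theorem theorem39 (n : nat) (hn : (1 <= n)%N) :
  second_order_eulerian n =
  \sum_(T in SYT n)
    (\prod_(1 <= i < n.+1)
       (box_sorting_index i (rows T)
        * (i`!)%:R ^+ rows_of_size i (rows T)))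
    *: 'X^(n + 1 - nrows (rows T)).
Proof.
rewrite second_order_eulerianE -[RHS]/(\sum_(T in SYT n) syt_term n (rows T)).
rewrite sum_SYT; case: n hn => // n _.
(* The two sums differ at order 0, where they are 1 and x; the operator of
   order 0 maps both to x, so the induction starts at order 1. *)
elim: n => [|n IHn]; last by rewrite stirling_sumS IHn -syt_sumS.
rewrite stirling_sumS syt_sumS !big_seq1.
rewrite -['X^(des [::])]scale1r /syt_term /syt_weight big_geq //.
rewrite !eulerian_step_monomial //= !mul1r !mulr0n !scale0r add0r addr0.
by rewrite /des.
Qed.
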